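(* Let $\Gamma$ be a finite, simple, connected graph having no singleton twin. Suppose that $\Gamma$ has exactly $n$ (non-singleton) twin classes, of sizes $m_1,\dots,m_n$. Then $$\beta(\Gamma)=\sum_{i=1}^n m_i-n.$$ Moreover, every minimal resolving set of $\Gamma$ is a basis of $\Gamma$.
   Context: For vertices $u,v$ of a finite, simple, connected graph $\Gamma$ with vertex set $V(\Gamma)$, $d_\Gamma(u,v)$ is the length of a shortest path between $u$ and $v$. The open neighborhood is $N(u)=\{v\in V(\Gamma): d_\Gamma(u,v)=1\}$ and the closed neighborhood is $N[u]=N(u)\cup\{u\}$. Vertices $u,v$ are called twins, written $u\equiv v$, if $N[u]=N[v]$ or $N(u)=N(v)$; this is an equivalence relation on $V(\Gamma)$. Its equivalence classes $\overline{u}$ are called twin classes. A vertex $u$ is called a singleton twin if $\overline{u}=\{u\}$. A set $W=\{w_1,\dots,w_k\}\subseteq V(\Gamma)$ is a resolving set if distinct vertices $v$ of $\Gamma$ have distinct representations $(d_\Gamma(v,w_1),\dots,d_\Gamma(v,w_k))$. A basis of $\Gamma$ is a resolving set of minimum cardinality, and this cardinality is the metric dimension $\beta(\Gamma)$. A resolving set is minimal if it contains no resolving set as a proper subset. *)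

(* Defs.v *)
From mathcomp Require Import all_boot.
Set Implicit Arguments. Unset Strict Implicit. Unset Printing Implicit Defensive.

(* A finite simple graph is a symmetric irreflexive adjacency relation on a
   finType of vertices. *)
Definition simple_graph (T : finType) (e : rel T) : Prop :=
  symmetric e /\ irreflexive e.

Definition connected_graph (T : finType) (e : rel T) : Prop :=
  forall u v : T, connect e u v.

Definition has_path (T : finType) (e : rel T) (u v : T) (k : nat) : bool :=
  [exists p : k.-tuple T, [&& path e u p, uniq (u :: p) & last u p == v]].

(* A path has length less than #|T|, so [find] returns the least length of a
   path from u to v, and the junk value #|T| if there is none (which does not
   happen in a connected graph). *)
Definition dist (T : finType) (e : rel T) (u v : T) : nat :=
  find (has_path e u v) (iota 0 #|T|).

Definition open_nbhd (T : finType) (e : rel T) (u : T) : {set T} :=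
  [set v | dist e u v == 1].

Definition closed_nbhd (T : finType) (e : rel T) (u : T) : {set T} :=
  u |: open_nbhd e u.

Definition twins (T : finType) (e : rel T) (u v : T) : bool :=
  (closed_nbhd e u == closed_nbhd e v) || (open_nbhd e u == open_nbhd e v).

Definition twin_class (T : finType) (e : rel T) (u : T) : {set T} :=
  [set v | twins e u v].

Definition twin_classes (T : finType) (e : rel T) : {set {set T}} :=
  [set twin_class e u | u : T].

Definition singleton_twin (T : finType) (e : rel T) (u : T) : bool :=
  twin_class e u == [set u].

(* The vector (d(v, w_1), ..., d(v, w_k)) for W = {w_1, ..., w_k}, where the
   elements of W are listed in the order of [enum W]. *)
Definition representation (T : finType) (e : rel T) (W : {set T}) (v : T) :
  seq nat := [seq dist e v w | w <- enum W].

Definition resolving (T : finType) (e : rel T) (W : {set T}) : bool :=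
  [forall u, forall v,
    (u != v) ==> (representation e W u != representation e W v)].

Definition basis (T : finType) (e : rel T) (W : {set T}) : bool :=
  resolving e W && [forall W', resolving e W' ==> (#|W| <= #|W'|)].

(* [arg min] is well defined because [set: T] is resolving, see [resolvingT]. *)
Definition metric_dim (T : finType) (e : rel T) : nat :=
  #|[arg min_(W < [set: T] | resolving e W) #|W| ]|.

Definition minimal_resolving (T : finType) (e : rel T) (W : {set T}) : bool :=
  minset (fun W' => resolving e W') W.

Lemma dist_eq0 (T : finType) (e : rel T) (u v : T) :
  (dist e u v == 0) = (u == v).
Proof.
have T_gt0 : 0 < #|T| by apply/card_gt0P; exists u.
rewrite /dist; case: #|T| T_gt0 => // n _ /=.
have -> : has_path e u v 0 = (u == v).
  apply/existsP/eqP => [[p]|->]; first by rewrite tuple0 /= => /eqP.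
  by exists [tuple]; rewrite /= eqxx.
by case: (u == v).
Qed.

Lemma resolvingT (T : finType) (e : rel T) : resolving e [set: T].
Proof.
apply/forallP=> u; apply/forallP=> v; apply/implyP; apply: contra => /eqP E.
have /eq_in_map/(_ u) : representation e [set: T] u = representation e [set: T] v by [].
rewrite mem_enum inE => /(_ isT) duv.
by rewrite eq_sym -(dist_eq0 e) -duv dist_eq0.
Qed.

Lemma metric_dim_basis (T : finType) (e : rel T) (W : {set T}) :
  basis e W -> #|W| = metric_dim e.
Proof.
case/andP=> rW /forallP minW; rewrite /metric_dim.
case: arg_minnP => [|W0 rW0 minW0]; first exact: resolvingT.
by apply/eqP; rewrite eqn_leq minW0 // andbT; apply: (implyP (minW W0)).
Qed.

(* Main.v *)
Require Import Defs.
From mathcomp Require Import all_boot all_fingroup.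
Set Implicit Arguments. Unset Strict Implicit. Unset Printing Implicit Defensive.

(** Two vertices are twins exactly when exchanging them is an automorphism of
    the graph ([twinsP], [twins_tperm_automorphism]).  Distances are invariant under
    automorphisms, so no vertex other than [u] and [v] themselves can tell
    twins [u] and [v] apart: a resolving set omits at most one vertex of each
    twin class.

    Conversely, suppose that [W] omits at most one vertex of each twin class
    and let [u], [v] be distinct vertices outside [W].  They are not twins, so
    a third vertex [x] is adjacent to exactly one of them.  If [x] is in [W],
    it resolves [u] and [v].  Otherwise [x], not being a singleton twin, has a
    twin [x'], which lies in [W] since [x] does not; it is at the same
    distances as [x] from [u] and [v], hence resolves them.

    So [W] is resolving if and only if [twin_class] is injective on the
    complement of [W] ([resolving_twin_class_inj]).  A minimal such [W] omits
    exactly one vertex of every class, as a vertex of a class contained in [W]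
    could be dropped.  All minimal resolving sets thus have the same size,
    the number of vertices minus the number of classes, and a resolving set of
    minimum size is one of them. *)

Lemma dist_eq1 (T : finType) (e : rel T) (irr : irreflexive e) (u v : T) :
  (dist e u v == 1) = e u v.
Proof.
have [<-|neq_uv] := eqVneq u v.
  by have /eqP-> : dist e u u == 0; rewrite ?dist_eq0 ?irr.
have T_gt1 : 1 < #|T|.
  by apply: leq_trans (max_card [set u; v]); rewrite cards2 neq_uv.
have path0 : has_path e u v 0 = false.
  by apply/existsP => -[p]; rewrite tuple0 /= (negPf neq_uv).
have path1 : has_path e u v 1 = e u v.
  apply/existsP/idP => [[[[|x []] // ?]]|e_uv].
    by rewrite /= andbT => /and3P[e_ux _ /eqP <-].
  by exists [tuple v]; rewrite /= e_uv inE neq_uv eqxx.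
by rewrite /dist; case: #|T| T_gt1 => [|[|k]] // _ /=; rewrite path0 path1; case: (e u v).
Qed.

Lemma has_path_perm (T : finType) (e : rel T) (s : {perm T}) :
  {mono s : x y / e x y} ->
  forall u v k, has_path e u v k -> has_path e (s u) (s v) k.
Proof.
move=> se u v k /existsP[p /and3P[e_p uniq_p /eqP <-]].
apply/existsP; exists (map_tuple s p); apply/and3P; split.
- by rewrite path_map (eq_path (e' := e)).
- by rewrite -map_cons map_inj_uniq //; apply: perm_inj.
- by rewrite last_map.
Qed.

Lemma dist_perm (T : finType) (e : rel T) (s : {perm T}) :
  {mono s : x y / e x y} -> {mono s : u v / dist e u v}.
Proof.
move=> se u v; apply: eq_find => k; apply/idP/idP; last exact: has_path_perm.
have se' : {mono (s^-1)%g : x y / e x y} by move=> x y; rewrite -se !permKV.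
by move/(has_path_perm se'); rewrite !permK.
Qed.

(** The two kinds of twins, adjacent and non-adjacent, differ only in whether
    [u] and [v] belong to the neighborhoods being compared; away from [u] and
    [v] both amount to the same condition. *)
Lemma twinsP (T : finType) (e : rel T) (simple : simple_graph e) (u v : T) :
  reflect (forall x, x != u -> x != v -> e u x = e v x) (twins e u v).
Proof.
have [sym irr] := simple.
have inN z x : (x \in open_nbhd e z) = e z x by rewrite inE dist_eq1.
apply: (iffP orP) => [[] /eqP/setP N x xu xv|N].
- by have := N x; rewrite !in_setU1 !inN (negPf xu) (negPf xv).
- by have := N x; rewrite !inN.
have [<-|neq_uv] := eqVneq u v; first by left.
have neq_vu : v != u by rewrite eq_sym.
case e_uv : (e u v); [left | right]; apply/eqP/setP => x;
  rewrite ?in_setU1 !inN.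
- have [->|xu] := eqVneq x u; first by rewrite sym e_uv orbT.
  by have [->|xv] := eqVneq x v; rewrite //= N.
- have [->|xu] := eqVneq x u; first by rewrite irr sym e_uv.
  by have [->|xv] := eqVneq x v; [rewrite irr e_uv | rewrite N].
Qed.

Lemma twins_tperm_automorphism (T : finType) (e : rel T)
    (simple : simple_graph e) (u v : T) :
  twins e u v -> {mono tperm u v : x y / e x y}.
Proof.
have [sym irr] := simple; move/(twinsP simple _ _) => N x y.
case: tpermP => [->|->|/eqP xu /eqP xv]; case: tpermP => [->|->|/eqP yu /eqP yv];
  by rewrite ?irr // 1?[e v u]sym ?N // [LHS]sym [RHS]sym N.
Qed.

Lemma twins_equivalence (T : finType) (e : rel T) :
  simple_graph e -> equivalence_rel (twins e).
Proof.
move=> simple; have [sym irr] := simple.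
have twins_sym : symmetric (twins e).
  by move=> x y; rewrite /twins !(eq_sym (_ _ x)).
have twins_trans : transitive (twins e).
  move=> v u w /(twinsP simple _ _) Nuv /(twinsP simple _ _) Nvw.
  apply/(twinsP simple _ _) => x xu xw.
  have [x_v|xv] := eqVneq x v; last by rewrite Nuv ?Nvw.
  rewrite {x}x_v in xu xw *.
  have [->|uw] := eqVneq u w; first by [].
  (* The twins [v] and [w] have the same adjacency to [u], and the twins [u]
     and [v] the same adjacency to [w], so the three pairs formed from [u], [v]
     and [w] are all edges or all non-edges. *)
  have [uv wu wv] : [/\ u != v, w != u & w != v] by rewrite eq_sym xu eq_sym uw eq_sym xw.
  by rewrite sym Nvw // sym Nuv // sym.
have twins_refl : reflexive (twins e) by move=> x; rewrite /twins eqxx.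
move=> x y z; split=> // xy; apply/idP/idP; last exact: twins_trans.
by apply: twins_trans; rewrite twins_sym.
Qed.

Lemma eq_twin_class (T : finType) (e : rel T) (u v : T) :
  simple_graph e -> (twin_class e u == twin_class e v) = twins e u v.
Proof.
move=> simple; have eqv := twins_equivalence simple.
apply/eqP/idP => [/setP/(_ v)|uv]; first by rewrite !inE (eqv v v v).1.
by apply/setP => x; rewrite !inE; apply: (eqv u v x).2.
Qed.

Lemma card_twin_classes (T : finType) (e : rel T) :
  simple_graph e -> \sum_(A in twin_classes e) #|A| = #|T|.
Proof.
move=> simple; rewrite -cardsT; symmetry; apply: card_partition.
have -> : twin_classes e = equivalence_partition (twins e) setT.
  rewrite /equivalence_partition /twin_classes -[RHS](eq_imset (f := twin_class e)).
    by apply/setP=> A; apply/imsetP/imsetP => -[x _ ->]; exists x.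
  by move=> x; apply/setP=> y; rewrite !inE.
by apply: equivalence_partitionP => x y z _ _ _; apply: twins_equivalence.
Qed.

Lemma resolvingP (T : finType) (e : rel T) (W : {set T}) :
  reflect (forall u v, {in W, forall w, dist e u w = dist e v w} -> u = v)
          (resolving e W).
Proof.
have reprE u v : reflect {in W, forall w, dist e u w = dist e v w}
                         (representation e W u == representation e W v).
  apply: (iffP eqP) => [/eq_in_map E w wW|E].
    by apply: E; rewrite mem_enum.
  by apply/eq_in_map => w; rewrite mem_enum; apply: E.
apply: (iffP forallP) => [res u v /reprE|inj u].
  by have /forallP/(_ v) := res u; case: eqVneq => //= _ /negPf->.
by apply/forallP => v; apply/implyP; apply: contraNN => /reprE/inj->.
Qed.

(** One direction holds because only [u] and [v] can resolve twins [u] and [v].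
    The other replaces a third vertex adjacent to exactly one of [u] and [v] by
    a twin of it in [W]; this is where singleton twins must be excluded. *)
Lemma resolving_twin_class_inj (T : finType) (e : rel T) (W : {set T}) :
  simple_graph e -> (forall u, ~~ singleton_twin e u) ->
  resolving e W <-> {in ~: W &, injective (twin_class e)}.
Proof.
move=> simple no_singleton; have [sym irr] := simple.
split=> [/resolvingP res u v|inj].
  rewrite !inE => uW vW /eqP; rewrite eq_twin_class // => uv; apply: res => w wW.
  rewrite -(dist_perm (twins_tperm_automorphism simple uv)) tpermL tpermD //.
    by apply: contraNneq uW => ->.
  by apply: contraNneq vW => ->.
apply/resolvingP => u v duv; apply/eqP.
have [uW|uW] := boolP (u \in W).
  by rewrite eq_sym -(dist_eq0 e) -duv // dist_eq0.
have [vW|vW] := boolP (v \in W); first by rewrite -(dist_eq0 e) duv // dist_eq0.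
apply/eqP/inj; rewrite ?inE //; apply/eqP; rewrite eq_twin_class //.
apply/(twinsP simple _ _) => x xu xv; rewrite -!dist_eq1 //; congr (_ == 1).
(* As [W] does not resolve [u] and [v], neither does a third vertex [x]: if it
   is outside [W], it has a twin [x'] in [W] at the same distances. *)
have [|xW] := boolP (x \in W); first exact: duv.
have xx : x \in twin_class e x.
  by rewrite inE; apply: (twins_equivalence simple x x x).1.
have /subsetPn[x' xx' x'x] : ~~ (twin_class e x \subset [set x]).
  apply: contra (no_singleton x) => sub.
  by rewrite /singleton_twin eqEsubset sub sub1set.
rewrite !inE in xx' x'x.
have x'W : x' \in W.
  apply: contraNT x'x => x'W; apply/eqP/inj; rewrite ?inE //.
  by apply/esym/eqP; rewrite eq_twin_class.
have dx' z : z \notin W -> z != x -> dist e z x = dist e z x'.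
  move=> zW zx; rewrite -(dist_perm (twins_tperm_automorphism simple xx')) tpermL.
  by rewrite tpermD 1?eq_sym //; apply: contraNneq zW => ->.
by rewrite !dx' 1?eq_sym //; apply: duv.
Qed.

(** A class contained in a minimal resolving set could lose a vertex, so every
    class is represented in the complement, by exactly one vertex. *)
Lemma card_minimal_resolving (T : finType) (e : rel T) (W : {set T}) :
  simple_graph e -> (forall u, ~~ singleton_twin e u) ->
  minimal_resolving e W -> #|W| = #|T| - #|twin_classes e|.
Proof.
move=> simple no_singleton /minsetP[resW minW].
have injE W' := resolving_twin_class_inj W' simple no_singleton.
have injW := (injE W).1 resW.
suff <- : [set twin_class e u | u in ~: W] = twin_classes e.
  by rewrite card_in_imset // -(cardsC W) addnK.
apply/setP => A; apply/idP/idP => [/imsetP[x _ ->]|/imsetP[x _ ->]].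
  exact: imset_f.
apply/contraT => Wx.
have xW : x \in W by apply: contraNT Wx => xW; rewrite imset_f ?inE.
suff /minW/(_ (subsetDl _ _))/setP/(_ x) : resolving e (W :\ x).
  by rewrite !inE xW eqxx.
apply/injE => y z; rewrite !inE !negb_and !negbK.
have notWx y' : y' \notin W -> twin_class e y' != twin_class e x.
  by move=> y'W; apply: contraNneq Wx => <-; rewrite imset_f ?inE.
case/predU1P=> [->|yW] /predU1P[->|zW] // /eqP.
- by rewrite eq_sym (negPf (notWx _ zW)).
- by rewrite (negPf (notWx _ yW)).
- by move/eqP; apply: injW; rewrite inE.
Qed.

Lemma minimum_resolving_minimal (T : finType) (e : rel T) (W : {set T}) :
  basis e W -> minimal_resolving e W.
Proof.
case/andP=> resW /forallP minW; apply/minsetP; split=> // W' resW' sub.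
by apply/eqP; rewrite eqEcard sub (implyP (minW W')).
Qed.

Theorem theorem1p2 (T : finType) (e : rel T)
    (simple : simple_graph e) (conn : connected_graph e)
    (no_singleton : forall u : T, ~~ singleton_twin e u)
    (n : nat) (C : 'I_n -> {set T}) (m : 'I_n -> nat)
    (C_inj : injective C)
    (C_classes : [set C i | i : 'I_n] = twin_classes e)
    (C_sizes : forall i : 'I_n, #|C i| = m i) :
  metric_dim e = (\sum_(i < n) m i) - n /\
  (forall W : {set T}, minimal_resolving e W -> basis e W).
Proof.
have card_min W := card_minimal_resolving (W := W) simple no_singleton.
have [B basisB] : exists B, basis e B.
  case: (arg_minnP (fun W : {set T} => #|W|) (resolvingT e)) => B resB minB.
  by exists B; rewrite /basis resB; apply/forallP => W; apply/implyP/minB.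
have cardB := card_min B (minimum_resolving_minimal basisB).
split=> [|W minW].
  rewrite -(metric_dim_basis basisB) cardB -(card_twin_classes simple) -C_classes.
  rewrite card_imset // card_ord big_imset /=; last by move=> i j _ _; apply: C_inj.
  by congr (_ - _); apply: eq_bigr => i _.
have [resW _] := minsetP minW.
rewrite /basis resW (card_min W minW) -cardB.
by case/andP: basisB.
Qed.
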